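(* Let $\mathrm{k}$ be a commutative $\mathbb{Q}$-algebra and $\lambda\in\mathrm{k}$. The comonads $G_\lambda$ and $H$ on the category $\mathrm{k}\text{-}\mathbf{Alg}$ of $\mathrm{k}$-algebras are cofree on copointed endofunctors of $\mathrm{k}\text{-}\mathbf{Alg}$, and the comonad map $\gamma\colon G_\lambda\to H$, with components $\gamma(a)_n=\sum_m\binom{n}{m}\lambda^m a_m$, is cofree on a map of copointed endofunctors.
   Context: Algebras are associative and unital, not necessarily commutative. $G_\lambda A$ is the $\mathrm{k}$-module $A^{\mathbb{N}}$ with multiplication $$(a\cdot^\lambda b)_n=\sum_{r+s+t=n}\binom{n}{r,s,t}\lambda^t a_{r+t}b_{s+t},\qquad \binom{n}{r,s,t}=\frac{n!}{r!\,s!\,t!},$$ and unit $(1,0,0,\dots)$; $HA$ is $A^{\mathbb{N}}$ with the pointwise $\mathrm{k}$-algebra structure. Both are comonads on $\mathrm{k}\text{-}\mathbf{Alg}$, with counit $a\mapsto a_0$ and comultiplication sending $a\in A^{\mathbb{N}}$ to the element of $(A^{\mathbb{N}})^{\mathbb{N}}$ with $m$th component $(a_{m+n})_{n\in\mathbb{N}}$. (These are the comonads induced by the forgetful functors to $\mathrm{k}\text{-}\mathbf{Alg}$, and their right adjoints, from, respectively, the category of $\mathrm{k}$-algebras with a $\mathrm{k}$-linear endomorphism $\partial$ satisfying $\partial(1)=0$, $\partial(ab)=(\partial a)b+a(\partial b)+\lambda(\partial a)(\partial b)$, and the category of $\mathrm{k}$-algebras with an algebra endomorphism.) The maps $\gamma$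 are the components of a comonad morphism $G_\lambda\to H$. A copointed endofunctor of a category $\mathcal{C}$ is an endofunctor $T$ with a natural transformation $\varepsilon\colon T\Rightarrow\mathrm{id}$; these are the objects of the slice category $[\mathcal{C},\mathcal{C}]/\mathrm{id}$. A comonad on $\mathcal{C}$ is cofree on a copointed endofunctor $(T,\varepsilon)$ if it is the value at $(T,\varepsilon)$ of a right adjoint to the forgetful functor $\mathbf{Cmd}(\mathcal{C})\to[\mathcal{C},\mathcal{C}]/\mathrm{id}$ from comonads to copointed endofunctors (i.e. it has the universal property of such a value). A comonad morphism between cofree comonads is cofree on a map of the generating copointed endofunctors if it is the one induced from that map by the universal property. *)

(* Defs.v *)
From HB Require Import structures.
From mathcomp Require Import all_boot all_order all_algebra.
From mathcomp Require Import boolp functions.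

Set Implicit Arguments.
Unset Strict Implicit.
Unset Printing Implicit Defensive.

Import GRing.Theory.
Local Open Scope ring_scope.

Declare Scope cat_scope.
Delimit Scope cat_scope with cat.

Record category := Category {
  obj :> Type;
  mor : obj -> obj -> Type;
  idm : forall A, mor A A;
  hcomp : forall A B D, mor B D -> mor A B -> mor A D;
  hcomp1m : forall A B (f : mor A B), hcomp (idm B) f = f;
  hcompm1 : forall A B (f : mor A B), hcomp f (idm A) = f;
  hcompA : forall A B D E (h : mor D E) (g : mor B D) (f : mor A B),
    hcomp h (hcomp g f) = hcomp (hcomp h g) f }.

Arguments mor {c} A B.
Arguments idm {c} A.
Arguments hcomp {c A B D} g f.

Notation "g ∘ f" := (hcomp g f) (at level 40, left associativity) : cat_scope.
Local Open Scope cat_scope.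

Record functor (C D : category) := Functor {
  fobj :> C -> D;
  fmap : forall A B : C, mor A B -> mor (fobj A) (fobj B);
  fmap1 : forall A : C, fmap (idm A) = idm (fobj A);
  fmapM : forall (A B E : C) (g : mor B E) (f : mor A B),
    fmap (g ∘ f) = fmap g ∘ fmap f }.

Arguments fmap {C D} F {A B} f : rename.

Definition idF (C : category) : functor C C :=
  @Functor C C id (fun _ _ f => f) (fun _ => erefl) (fun _ _ _ _ _ => erefl).

Lemma compF_subproof1 (C D E : category) (G : functor D E) (F : functor C D)
  (A : C) : fmap G (fmap F (idm A)) = idm (G (F A)).
Proof. by rewrite !fmap1. Qed.

Lemma compF_subproofM (C D E : category) (G : functor D E) (F : functor C D)
    (A B X : C) (g : mor B X) (f : mor A B) :
  fmap G (fmap F (g ∘ f)) = fmap G (fmap F g) ∘ fmap G (fmap F f).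
Proof. by rewrite !fmapM. Qed.

Definition compF (C D E : category) (G : functor D E) (F : functor C D) :
    functor C E :=
  Functor (compF_subproof1 G F) (compF_subproofM G F).

Record nat_trans (C D : category) (F G : functor C D) := NatTrans {
  nt :> forall A : C, mor (F A) (G A);
  naturality : forall (A B : C) (f : mor A B),
    nt B ∘ fmap F f = fmap G f ∘ nt A }.

Lemma nat_transP (C D : category) (F G : functor C D) (s t : nat_trans F G) :
  (forall A, s A = t A) -> s = t.
Proof.
case: s t => [s Hs] [t Ht] /= E0.
have {E0}E : s = t := functional_extensionality_dep E0.
by move: Hs Ht; rewrite E => Hs Ht; congr NatTrans; apply: Prop_irrelevance.
Qed.

Lemma idN_subproof (C D : category) (F : functor C D) (A B : C) (f : mor A B) :
  idm (F B) ∘ fmap F f = fmap F f ∘ idm (F A).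
Proof. by rewrite hcomp1m hcompm1. Qed.

Definition idN (C D : category) (F : functor C D) : nat_trans F F :=
  NatTrans (@idN_subproof C D F).

Lemma compN_subproof (C D : category) (F G H : functor C D)
    (t : nat_trans G H) (s : nat_trans F G) (A B : C) (f : mor A B) :
  (t B ∘ s B) ∘ fmap F f = fmap H f ∘ (t A ∘ s A).
Proof. by rewrite -hcompA naturality hcompA naturality hcompA. Qed.

Definition compN (C D : category) (F G H : functor C D)
    (t : nat_trans G H) (s : nat_trans F G) : nat_trans F H :=
  NatTrans (compN_subproof t s).

(* Objects and morphisms of the slice category [C, C] / id. *)
Record copointed (C : category) := Copointed {
  cp_functor :> functor C C;
  cp_counit : nat_trans cp_functor (idF C) }.

Record copointed_hom (C : category) (S T : copointed C) := CopointedHom {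
  cph_nt :> nat_trans S T;
  cph_counit : forall A : C, cp_counit T A ∘ cph_nt A = cp_counit S A }.

Lemma copointed_homP (C : category) (S T : copointed C)
  (f g : copointed_hom S T) : (forall A, f A = g A) -> f = g.
Proof.
case: f g => [f Hf] [g Hg] /= E0.
have {E0}E : f = g := nat_transP E0.
by move: Hf Hg; rewrite E => Hf Hg; congr CopointedHom; apply: Prop_irrelevance.
Qed.

Definition copointed_idm (C : category) (S : copointed C) : copointed_hom S S :=
  @CopointedHom C S S (idN S) (fun A => hcompm1 _).

Lemma copointed_comp_subproof (C : category) (S T V : copointed C)
    (g : copointed_hom T V) (f : copointed_hom S T) (A : C) :
  cp_counit V A ∘ compN g f A = cp_counit S A.
Proof. by rewrite /= hcompA !cph_counit. Qed.

Definition copointed_comp (C : category) (S T V : copointed C)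
    (g : copointed_hom T V) (f : copointed_hom S T) : copointed_hom S V :=
  CopointedHom (copointed_comp_subproof g f).

Definition Copt (C : category) : category.
Proof.
refine (@Category (copointed C) (@copointed_hom C) (@copointed_idm C)
          (@copointed_comp C) _ _ _).
- by move=> *; apply: copointed_homP => A; apply: hcomp1m.
- by move=> *; apply: copointed_homP => A; apply: hcompm1.
- by move=> *; apply: copointed_homP => A; apply: hcompA.
Defined.

Record comonad (C : category) := Comonad {
  cm_functor :> functor C C;
  counit : nat_trans cm_functor (idF C);
  comult : nat_trans cm_functor (compF cm_functor cm_functor);
  comonad_counitl : forall A : C,
    counit (cm_functor A) ∘ comult A = idm (cm_functor A);
  comonad_counitr : forall A : C,
    fmap cm_functor (counit A) ∘ comult A = idm (cm_functor A);
  comonad_coassoc : forall A : C,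
    comult (cm_functor A) ∘ comult A = fmap cm_functor (comult A) ∘ comult A }.

Record comonad_hom (C : category) (D G : comonad C) := ComonadHom {
  cmh_nt :> nat_trans D G;
  cmh_counit : forall A : C, counit G A ∘ cmh_nt A = counit D A;
  cmh_comult : forall A : C,
    comult G A ∘ cmh_nt A = fmap G (cmh_nt A) ∘ cmh_nt (D A) ∘ comult D A }.

Lemma comonad_homP (C : category) (D G : comonad C) (f g : comonad_hom D G) :
  (forall A, f A = g A) -> f = g.
Proof.
case: f g => [f Hf Hf'] [g Hg Hg'] /= E0.
have {E0}E : f = g := nat_transP E0.
move: Hf Hf' Hg Hg'; rewrite E => Hf Hf' Hg Hg'.
by congr ComonadHom; apply: Prop_irrelevance.
Qed.

Lemma comonad_idm_subproof (C : category) (G : comonad C) (A : C) :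
  comult G A ∘ idN G A = fmap G (idN G A) ∘ idN G (G A) ∘ comult G A.
Proof. by rewrite /= fmap1 hcompm1 !hcomp1m. Qed.

Definition comonad_idm (C : category) (G : comonad C) : comonad_hom G G :=
  @ComonadHom C G G (idN G) (fun A => hcompm1 _) (@comonad_idm_subproof C G).

Lemma comonad_comp_subproof1 (C : category) (D G H : comonad C)
    (g : comonad_hom G H) (f : comonad_hom D G) (A : C) :
  counit H A ∘ compN g f A = counit D A.
Proof. by rewrite /= hcompA !cmh_counit. Qed.

Lemma comonad_comp_subproof2 (C : category) (D G H : comonad C)
    (g : comonad_hom G H) (f : comonad_hom D G) (A : C) :
  comult H A ∘ compN g f A
  = fmap H (compN g f A) ∘ compN g f (D A) ∘ comult D A.
Proof.
rewrite /= hcompA cmh_comult -hcompA cmh_comult fmapM !hcompA.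
congr (_ ∘ _ ∘ _); rewrite -!hcompA; congr (_ ∘ _).
by rewrite naturality.
Qed.

Definition comonad_comp (C : category) (D G H : comonad C)
    (g : comonad_hom G H) (f : comonad_hom D G) : comonad_hom D H :=
  ComonadHom (comonad_comp_subproof1 g f) (comonad_comp_subproof2 g f).

Definition Cmd (C : category) : category.
Proof.
refine (@Category (comonad C) (@comonad_hom C) (@comonad_idm C)
          (@comonad_comp C) _ _ _).
- by move=> *; apply: comonad_homP => A; apply: hcomp1m.
- by move=> *; apply: comonad_homP => A; apply: hcompm1.
- by move=> *; apply: comonad_homP => A; apply: hcompA.
Defined.

Definition forget_obj (C : category) (G : comonad C) : copointed C :=
  Copointed (counit G).

Definition forget_hom (C : category) (D G : comonad C) (f : comonad_hom D G) :
    copointed_hom (forget_obj D) (forget_obj G) :=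
  @CopointedHom C (forget_obj D) (forget_obj G) f (cmh_counit f).

Definition forget (C : category) : functor (Cmd C) (Copt C).
Proof.
refine (@Functor (Cmd C) (Copt C) (@forget_obj C) (@forget_hom C) _ _).
- by move=> A; apply: copointed_homP.
- by move=> *; apply: copointed_homP.
Defined.

(* [q : U x -> y] exhibits [x] as the value at [y] of a right adjoint to [U]. *)
Definition is_coreflection (C D : category) (U : functor C D) (y : D) (x : C)
    (q : mor (U x) y) : Prop :=
  forall (z : C) (f : mor (U z) y), exists! g : mor z x, q ∘ fmap U g = f.

Definition is_cofree (C : category) (T : Copt C) (G : Cmd C)
    (q : mor (forget C G) T) : Prop :=
  is_coreflection q.

(* When [q'] is cofree, its universal property gives a unique [g] satisfying
   this equation: the comonad map induced by [phi]. *)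
Definition is_cofree_on_map (C : category) (S T : Copt C) (D G : Cmd C)
    (q : mor (forget C D) S) (q' : mor (forget C G) T)
    (phi : mor S T) (g : mor D G) : Prop :=
  q' ∘ fmap (forget C) g = phi ∘ q.

(* Associative unital k-algebras. The structure algType of the library excludes
   the zero algebra, which is an object of the category of k-algebras. *)
Record kalgebra (k : pzRingType) := KAlgebra {
  kalg_lmod : lmodType k;
  kalg_one : kalg_lmod;
  kalg_mul : kalg_lmod -> kalg_lmod -> kalg_lmod;
  kalg_mulA : associative kalg_mul;
  kalg_mul1 : left_id kalg_one kalg_mul;
  kalg_mulr1 : right_id kalg_one kalg_mul;
  kalg_mulDl : left_distributive kalg_mul +%R;
  kalg_mulDr : right_distributive kalg_mul +%R;
  kalg_scaleAl : forall (c : k) (x y : kalg_lmod),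
    c *: kalg_mul x y = kalg_mul (c *: x) y;
  kalg_scaleAr : forall (c : k) (x y : kalg_lmod),
    c *: kalg_mul x y = kalg_mul x (c *: y) }.

Definition kalg_sort (k : pzRingType) (A : kalgebra k) : Type := kalg_lmod A.
Coercion kalg_sort : kalgebra >-> Sortclass.

HB.instance Definition _ (k : pzRingType) (A : kalgebra k) :=
  GRing.Lmodule.copy (kalg_sort A) (kalg_lmod A).
HB.instance Definition _ (k : pzRingType) (A : kalgebra k) :=
  GRing.Zmodule_isPzRing.Build (kalg_sort A) (@kalg_mulA k A)
    (@kalg_mul1 k A) (@kalg_mulr1 k A) (@kalg_mulDl k A) (@kalg_mulDr k A).

Lemma kscaleAl (k : pzRingType) (A : kalgebra k) (c : k) (x y : A) :
  c *: (x * y) = (c *: x) * y.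
Proof. exact: kalg_scaleAl. Qed.

Lemma kscaleAr (k : pzRingType) (A : kalgebra k) (c : k) (x y : A) :
  c *: (x * y) = x * (c *: y).
Proof. exact: kalg_scaleAr. Qed.

Record alg_hom (k : pzRingType) (A B : kalgebra k) := AlgHom {
  alg_fun :> A -> B;
  alg_linear : linear alg_fun;
  alg_monoid : monoid_morphism alg_fun }.

HB.instance Definition _ (k : pzRingType) (A B : kalgebra k)
    (f : alg_hom A B) :=
  GRing.isLinear.Build k A B *:%R (alg_fun f) (alg_linear f).
HB.instance Definition _ (k : pzRingType) (A B : kalgebra k)
    (f : alg_hom A B) :=
  GRing.isMonoidMorphism.Build A B (alg_fun f) (alg_monoid f).

Lemma alg_homP (k : pzRingType) (A B : kalgebra k) (f g : alg_hom A B) :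
  f =1 g -> f = g.
Proof.
case: f g => [f Hf Hf'] [g Hg Hg'] /= E0.
have {E0}E : f = g := funext E0.
move: Hf Hf' Hg Hg'; rewrite E => Hf Hf' Hg Hg'.
by congr AlgHom; apply: Prop_irrelevance.
Qed.

Lemma alg_idm_linear (k : pzRingType) (A : kalgebra k) : linear (@id A).
Proof. by []. Qed.

Lemma alg_idm_monoid (k : pzRingType) (A : kalgebra k) :
  monoid_morphism (@id A).
Proof. by []. Qed.

Definition alg_idm (k : pzRingType) (A : kalgebra k) : alg_hom A A :=
  AlgHom (@alg_idm_linear k A) (@alg_idm_monoid k A).

Lemma alg_comp_linear (k : pzRingType) (A B D : kalgebra k)
  (g : alg_hom B D) (f : alg_hom A B) : linear (g \o f).
Proof. by move=> c x y; rewrite /= !linearP. Qed.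

Lemma alg_comp_monoid (k : pzRingType) (A B D : kalgebra k)
  (g : alg_hom B D) (f : alg_hom A B) : monoid_morphism (g \o f).
Proof. by split=> [|x y] /=; rewrite ?rmorph1 ?rmorphM. Qed.

Definition alg_comp (k : pzRingType) (A B D : kalgebra k)
    (g : alg_hom B D) (f : alg_hom A B) : alg_hom A D :=
  AlgHom (alg_comp_linear g f) (alg_comp_monoid g f).

Definition kAlg (k : pzRingType) : category.
Proof.
refine (@Category (kalgebra k) (@alg_hom k) (@alg_idm k) (@alg_comp k) _ _ _);
by move=> *; apply: alg_homP.
Defined.

Lemma sum_binS (V : nmodType) (f : nat -> nat -> V) n :
  \sum_(i < n.+2) f i (n.+1 - i)%N *+ 'C(n.+1, i)
  = \sum_(i < n.+1) f i.+1 (n - i)%N *+ 'C(n, i)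
    + \sum_(i < n.+1) f i (n - i).+1 *+ 'C(n, i).
Proof.
rewrite big_ord_recl /= subn0 bin0.
under eq_bigr => i _ do rewrite /bump /= add1n subSS binS mulrnDr.
rewrite big_split /= addrA addrC; congr (_ + _).
rewrite [RHS]big_ord_recl subn0 bin0; congr (_ + _).
rewrite big_ord_recr /= bin_small // mulr0n addr0.
by apply: eq_bigr => i _; rewrite /bump /= add1n subnSK.
Qed.

Lemma sum_trinE (V : nmodType) (F : nat -> nat -> nat -> V) n :
  \sum_(r < n.+1) \sum_(s < n.+1) \sum_(t < n.+1 | (r + s + t == n)%N)
     F r s t *+ (n`! %/ (r`! * s`! * t`!))
  = \sum_(r < n.+1)
      (\sum_(s < (n - r).+1) F r s (n - r - s)%N *+ 'C(n - r, s)) *+ 'C(n, r).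
Proof.
apply: eq_bigr => r _; have rn : (r <= n)%N by rewrite -ltnS.
rewrite -sumrMnl (big_ord_widen n.+1 (fun s => F r s (n - r - s)%N
  *+ 'C(n - r, s) *+ 'C(n, r))) ?ltnS ?leq_subr //.
rewrite [RHS]big_mkcond; apply: eq_bigr => s _; rewrite ltnS.
case: leqP => [sn | sn]; last first.
  rewrite big_pred0 // => t; apply/negbTE; rewrite neq_ltn; apply/orP; right.
  by rewrite (leq_trans _ (leq_addr _ _)) // -ltn_subLR.
have tn : (n - r - s < n.+1)%N by rewrite ltnS -subnDA leq_subr.
rewrite (big_pred1 (Ordinal tn)) => [|t] /=; last first.
  rewrite -val_eqE /= -subnDA; move: sn; rewrite leq_subRL // => sn.
  apply/eqP/eqP => [E | ->]; last exact: subnKC.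
  by have := addKn (r + s) t; rewrite E.
rewrite -mulrnA; congr (_ *+ _).
have -> : n`! = ('C(n - r, s) * 'C(n, r) * (r`! * s`! * (n - r - s)`!))%N.
  rewrite -(bin_fact rn) -(bin_fact sn) !mulnA.
  by rewrite (ACl (3*1*2*4*5))%AC.
by rewrite mulnK // !muln_gt0 !fact_gt0.
Qed.

Section WeightedSequences.
Variables (k : comPzRingType) (lam : k).

Definition gmul (A : kalgebra k) (a b : nat -> A) (n : nat) : A :=
  \sum_(r < n.+1) \sum_(s < n.+1) \sum_(t < n.+1 | (r + s + t == n)%N)
    ((n`! %/ (r`! * s`! * t`!))%:R * lam ^+ t) *: (a (r + t)%N * b (s + t)%N).

Definition gone (A : kalgebra k) (n : nat) : A := (n == 0)%:R.

Definition shift (T : Type) (a : nat -> T) (n : nat) : T := a n.+1.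

Lemma gmul0 (A : kalgebra k) (a b : nat -> A) : gmul a b 0 = a 0 * b 0.
Proof.
rewrite /gmul !big_ord1 (big_pred1 ord0) => [|t]; last by rewrite ord1.
by rewrite /= expr0 mulr1 divnn scale1r.
Qed.

Lemma gmul_binE (A : kalgebra k) (a b : nat -> A) n :
  gmul a b n = \sum_(r < n.+1) (\sum_(s < (n - r).+1)
    lam ^+ (n - r - s) *: (a (r + (n - r - s))%N * b (s + (n - r - s))%N)
      *+ 'C(n - r, s)) *+ 'C(n, r).
Proof.
rewrite -(sum_trinE (fun r s t => lam ^+ t *: (a (r + t)%N * b (s + t)%N))).
do 3 (apply: eq_bigr => ? _).
by rewrite mulr_natl scalerMnl.
Qed.

Lemma gmulS (A : kalgebra k) (a b : nat -> A) n :
  gmul a b n.+1 = gmul (shift a) b n + gmul a (shift b) n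
                  + lam *: gmul (shift a) (shift b) n.
Proof.
rewrite !gmul_binE (sum_binS (fun r m => \sum_(s < m.+1)
  lam ^+ (m - s) *: (a (r + (m - s))%N * b (s + (m - s))%N) *+ 'C(m, s))).
rewrite -addrA; congr (_ + _); rewrite scaler_sumr -big_split /=.
apply: eq_bigr => r _; rewrite -scalerMnr -mulrnDl; congr (_ *+ _).
rewrite (sum_binS (fun s m => lam ^+ m *: (a (r + m)%N * b (s + m)%N))).
congr (_ + _); rewrite scaler_sumr; apply: eq_bigr => s _.
by rewrite -scalerMnr; congr (_ *+ _); rewrite exprS scalerA /shift !addnS.
Qed.

Lemma seq_addE (V : nmodType) (a b : nat -> V) n : (a + b) n = a n + b n.
Proof. by []. Qed.

Lemma seq_scaleE (V : lmodType k) (c : k) (a : nat -> V) n :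
  (c *: a) n = c *: a n.
Proof. by []. Qed.

Definition seqE := (seq_addE, seq_scaleE).

Lemma gmulDl (A : kalgebra k) (a b c : nat -> A) :
  gmul (a + b) c = gmul a c + gmul b c.
Proof.
apply/funext => n; rewrite seqE /gmul.
do 3 (rewrite -big_split /=; apply: eq_bigr => ? _).
by rewrite /= -scalerDr -mulrDl.
Qed.

Lemma gmulDr (A : kalgebra k) (a b c : nat -> A) :
  gmul a (b + c) = gmul a b + gmul a c.
Proof.
apply/funext => n; rewrite seqE /gmul.
do 3 (rewrite -big_split /=; apply: eq_bigr => ? _).
by rewrite /= -scalerDr -mulrDr.
Qed.

Lemma gmulZl (A : kalgebra k) c (a b : nat -> A) :
  c *: gmul a b = gmul (c *: a) b.
Proof.
apply/funext => n; rewrite seqE /gmul.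
do 3 (rewrite scaler_sumr; apply: eq_bigr => ? _).
by rewrite /= -kscaleAl !scalerA mulrC.
Qed.

Lemma gmulZr (A : kalgebra k) c (a b : nat -> A) :
  c *: gmul a b = gmul a (c *: b).
Proof.
apply/funext => n; rewrite seqE /gmul.
do 3 (rewrite scaler_sumr; apply: eq_bigr => ? _).
by rewrite /= -kscaleAr !scalerA mulrC.
Qed.

Lemma shift_gmul (A : kalgebra k) (a b : nat -> A) :
  shift (gmul a b)
  = gmul (shift a) b + gmul a (shift b) + lam *: gmul (shift a) (shift b).
Proof. by apply/funext => n; rewrite /shift gmulS. Qed.

Lemma gmulA (A : kalgebra k) : associative (@gmul A).
Proof.
move=> a b c; apply/funext => n; elim: n a b c => [|n IHn] a b c.
  by rewrite !gmul0 mulrA.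
rewrite !gmulS !shift_gmul !(gmulDl, gmulDr) -!(gmulZl, gmulZr) !seqE.
rewrite !IHn !scalerDr.
by rewrite !addrA; rewrite (ACl (1*2*5*3*6*4*7))%AC.
Qed.

Lemma shift_gone (A : kalgebra k) : shift (@gone A) = 0.
Proof. by []. Qed.

Lemma gmul1 (A : kalgebra k) : left_id (@gone A) (@gmul A).
Proof.
move=> a; apply/funext => n; elim: n a => [|n IHn] a.
  by rewrite gmul0 mul1r.
have g0 (b : nat -> A) : gmul (0 : nat -> A) b = 0.
  by have := gmulZl 0 0 b; rewrite !scale0r => <-.
by rewrite gmulS shift_gone !g0 IHn scaler0 addr0 add0r.
Qed.

Lemma gmulr1 (A : kalgebra k) : right_id (@gone A) (@gmul A).
Proof.
move=> a; apply/funext => n; elim: n a => [|n IHn] a.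
  by rewrite gmul0 mulr1.
have g0 (b : nat -> A) : gmul b (0 : nat -> A) = 0.
  by have := gmulZr 0 b 0; rewrite !scale0r => <-.
by rewrite gmulS shift_gone !g0 IHn scaler0 !addr0.
Qed.

Definition G_alg (A : kalgebra k) : kalgebra k :=
  @KAlgebra k (nat -> A) (@gone A) (@gmul A) (@gmulA A) (@gmul1 A) (@gmulr1 A)
    (fun a b c => gmulDl a b c) (fun a b c => gmulDr a b c)
    (@gmulZl A) (@gmulZr A).

Lemma seqmap_linear (A B : kalgebra k) (f : alg_hom A B) :
  linear (fun a : nat -> A => f \o a).
Proof. by move=> c a b; apply/funext => n; rewrite /= !seqE linearP. Qed.

Lemma gmap_monoid (A B : kalgebra k) (f : alg_hom A B) :
  monoid_morphism ((fun a : nat -> A => f \o a) : G_alg A -> G_alg B).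
Proof.
split; first by apply/funext => n; rewrite /= rmorph_nat.
move=> a b; apply/funext => n.
rewrite /= /GRing.mul /= /gmul.
do 3 (rewrite linear_sum; apply: eq_bigr => ? _).
by rewrite linearZ rmorphM.
Qed.

Definition gmap (A B : kalgebra k) (f : alg_hom A B) :
    alg_hom (G_alg A) (G_alg B) :=
  @AlgHom k (G_alg A) (G_alg B) (fun a => f \o a) (seqmap_linear f)
    (gmap_monoid f).

Definition G_functor : functor (kAlg k) (kAlg k).
Proof.
refine (@Functor (kAlg k) (kAlg k) G_alg gmap _ _);
by move=> *; apply: alg_homP.
Defined.

Definition G_counit_hom (A : kalgebra k) : alg_hom (G_alg A) A.
Proof.
refine (@AlgHom k (G_alg A) A (fun a => a 0%N) _ _) => //.
by split=> // a b; apply: gmul0.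
Defined.

Definition G_counit : nat_trans G_functor (idF (kAlg k)).
Proof.
refine (@NatTrans (kAlg k) (kAlg k) G_functor (idF _) G_counit_hom _).
by move=> *; apply: alg_homP.
Defined.

Definition seqdup (T : Type) (a : nat -> T) (m n : nat) : T := a (m + n)%N.

Lemma shift_seqdup (T : Type) (a : nat -> T) :
  shift (seqdup a) = seqdup (shift a).
Proof. by []. Qed.

Lemma seqdup_gmul (A : kalgebra k) (a b : nat -> A) m :
  seqdup (gmul a b) m
  = gmul (A := G_alg A) (seqdup a) (seqdup b) m.
Proof.
elim: m a b => [|m IHm] a b; first by rewrite gmul0.
rewrite gmulS !shift_seqdup -!IHm.
by apply/funext => n; rewrite /seqdup addSn gmulS.
Qed.

Definition G_comult_hom (A : kalgebra k) :
  alg_hom (G_alg A) (G_alg (G_alg A)).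
Proof.
refine (@AlgHom k (G_alg A) (G_alg (G_alg A)) (@seqdup A) _ _) => //.
split; last by move=> a b; apply/funext => m; apply: seqdup_gmul.
by apply/funext => -[|m]; apply/funext.
Defined.

Definition G_comult : nat_trans G_functor (compF G_functor G_functor).
Proof.
refine (@NatTrans (kAlg k) (kAlg k) G_functor (compF G_functor G_functor)
          G_comult_hom _).
by move=> *; apply: alg_homP.
Defined.

Definition comonadG : comonad (kAlg k).
Proof.
refine (@Comonad (kAlg k) G_functor G_counit G_comult _ _ _) => A;
  apply: alg_homP => a //.
- by apply/funext => n; rewrite /= /seqdup addn0.
- by do 3 apply/funext => ?; rewrite /= /seqdup addnA.
Defined.

Definition H_alg (A : kalgebra k) : kalgebra k.
Proof.
refine (@KAlgebra k (nat -> A) (fun=> 1) (fun a b n => a n * b n)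
          _ _ _ _ _ _ _).
- by move=> a b c; apply/funext => n; apply: mulrA.
- by move=> a; apply/funext => n; apply: mul1r.
- by move=> a; apply/funext => n; apply: mulr1.
- by move=> a b c; apply/funext => n; apply: mulrDl.
- by move=> a b c; apply/funext => n; apply: mulrDr.
- by move=> c a b; apply/funext => n; apply: kscaleAl.
- by move=> c a b; apply/funext => n; apply: kscaleAr.
Defined.

Definition hmap (A B : kalgebra k) (f : alg_hom A B) :
  alg_hom (H_alg A) (H_alg B).
Proof.
refine (@AlgHom k (H_alg A) (H_alg B) (fun a => f \o a)
          (seqmap_linear f) _).
by split=> [|a b]; apply/funext => n; [apply: rmorph1|apply: rmorphM].
Defined.

Definition H_functor : functor (kAlg k) (kAlg k).
Proof.
refine (@Functor (kAlg k) (kAlg k) H_alg hmap _ _);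
by move=> *; apply: alg_homP.
Defined.

Definition H_counit_hom (A : kalgebra k) : alg_hom (H_alg A) A.
Proof. by refine (@AlgHom k (H_alg A) A (fun a => a 0%N) _ _). Defined.

Definition H_counit : nat_trans H_functor (idF (kAlg k)).
Proof.
refine (@NatTrans (kAlg k) (kAlg k) H_functor (idF _) H_counit_hom _).
by move=> *; apply: alg_homP.
Defined.

Definition H_comult_hom (A : kalgebra k) :
  alg_hom (H_alg A) (H_alg (H_alg A)).
Proof.
by refine (@AlgHom k (H_alg A) (H_alg (H_alg A)) (@seqdup A) _ _).
Defined.

Definition H_comult : nat_trans H_functor (compF H_functor H_functor).
Proof.
refine (@NatTrans (kAlg k) (kAlg k) H_functor (compF H_functor H_functor)
          H_comult_hom _).
by move=> *; apply: alg_homP.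
Defined.

Definition comonadH : comonad (kAlg k).
Proof.
refine (@Comonad (kAlg k) H_functor H_counit H_comult _ _ _) => A;
  apply: alg_homP => a //.
- by apply/funext => n; rewrite /= /seqdup addn0.
- by do 3 apply/funext => ?; rewrite /= /seqdup addnA.
Defined.

Definition gam (A : kalgebra k) (a : nat -> A) (n : nat) : A :=
  \sum_(m < n.+1) ('C(n, m)%:R * lam ^+ m) *: a m.

Lemma gam0 (A : kalgebra k) (a : nat -> A) : gam a 0 = a 0.
Proof. by rewrite /gam big_ord1 bin0 expr0 mulr1 scale1r. Qed.

Lemma gamS (A : kalgebra k) (a : nat -> A) n :
  gam a n.+1 = gam a n + lam *: gam (shift a) n.
Proof.
have gE (b : nat -> A) m :
    gam b m = \sum_(i < m.+1) (lam ^+ i *: b i) *+ 'C(m, i).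
  by apply: eq_bigr => i _; rewrite mulr_natl scalerMnl.
rewrite !gE (sum_binS (fun i _ => lam ^+ i *: a i)) addrC; congr (_ + _).
rewrite scaler_sumr; apply: eq_bigr => i _.
by rewrite -scalerMnr exprS scalerA.
Qed.

Lemma gam_linear (A : kalgebra k) : linear (@gam A).
Proof.
move=> c a b; apply/funext => n; rewrite !seqE /gam.
rewrite scaler_sumr -big_split /=; apply: eq_bigr => i _.
by rewrite !seqE scalerDr !scalerA [c * _]mulrC.
Qed.

Lemma gamD (A : kalgebra k) (a b : nat -> A) n :
  gam (a + b) n = gam a n + gam b n.
Proof. by have := gam_linear 1 a b; rewrite !scale1r => ->. Qed.

Lemma gamZ (A : kalgebra k) c (a : nat -> A) n :
  gam (c *: a) n = c *: gam a n.
Proof.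
rewrite /gam scaler_sumr; apply: eq_bigr => i _.
by rewrite seqE !scalerA mulrC.
Qed.

Lemma gamM (A : kalgebra k) (a b : nat -> A) n :
  gam (gmul a b) n = gam a n * gam b n.
Proof.
elim: n a b => [|n IHn] a b; first by rewrite !gam0 gmul0.
rewrite !gamS shift_gmul !gamD gamZ !IHn.
rewrite mulrDl !mulrDr -!kscaleAl -!kscaleAr !scalerDr.
by rewrite !addrA (ACl (1*3*2*4))%AC.
Qed.

Lemma gam_gone (A : kalgebra k) n : gam (@gone A) n = 1.
Proof.
rewrite /gam big_ord_recl bin0 expr0 mulr1 scale1r big1 ?addr0 //= => i _.
by rewrite /gone /= scaler0.
Qed.

Definition gamma_hom (A : kalgebra k) : alg_hom (G_alg A) (H_alg A).
Proof.
refine (@AlgHom k (G_alg A) (H_alg A) (@gam A) (@gam_linear A) _).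
split; first by apply/funext => n; apply: gam_gone.
by move=> a b; apply/funext => n; apply: gamM.
Defined.

Lemma alg_hom_gam (A B : kalgebra k) (f : alg_hom A B) (a : nat -> A) n :
  f (gam a n) = gam (f \o a) n.
Proof.
by rewrite /gam linear_sum; apply: eq_bigr => i _; rewrite linearZ.
Qed.

Definition gamma_nt : nat_trans G_functor H_functor.
Proof.
refine (@NatTrans (kAlg k) (kAlg k) G_functor H_functor gamma_hom _).
by move=> A B f; apply: alg_homP => a; apply/funext => n;
  rewrite /= alg_hom_gam.
Defined.

Lemma gam_seqdup (A : kalgebra k) (a : nat -> A) m n :
  gam (gam (A := G_alg A) (seqdup a) m) n = gam a (m + n).
Proof.
elim: m a => [|m IHm] a; first by rewrite gam0.
rewrite gamS shift_seqdup.
rewrite (gamD (gam (A := G_alg A) (seqdup a) m)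
           (lam *: gam (A := G_alg A) (seqdup (shift a)) m)).
by rewrite (gamZ lam (gam (A := G_alg A) _ m)) !IHm addSn gamS.
Qed.

Definition gamma : comonad_hom comonadG comonadH.
Proof.
refine (@ComonadHom (kAlg k) comonadG comonadH gamma_nt _ _) => A;
  apply: alg_homP => a.
- exact: gam0.
- by do 2 apply/funext => ?; rewrite /= gam_seqdup.
Defined.

End WeightedSequences.

(* Main.v *)
Require Import Defs.
From mathcomp Require Import all_boot all_order all_algebra.
From mathcomp Require Import boolp functions.

(** A copointed endofunctor [T] has its own notion of coalgebra: a section
    [A -> T A] of the counit.  If the comonad [G] has the same coalgebras (with
    the same morphisms) as [T], then it is cofree on [T]: for a comonad [D], a
    map [D -> T] turns each [D A] into a [T]-coalgebra, hence into a
    [G]-coalgebra [D A -> G (D A)], and composing with [G] of the counit of [D]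
    gives the induced comonad map.  Now take [T A] to be [A * A], seen as the
    first two terms of a sequence in [A].  A [T]-coalgebra is then an algebra
    with a derivation of weight [lam] (for [G_lam]) or with an endomorphism (for
    [H]), and the [G]-coalgebra structure is recovered by iterating it.  The
    first two terms of [gamma a] being [a 0] and [a 0 + lam *: a 1], [gamma] is
    induced by [(x, y) |-> (x, x + lam *: y)]. *)

Set Implicit Arguments.
Unset Strict Implicit.
Unset Printing Implicit Defensive.

Import GRing.Theory.
Local Open Scope ring_scope.
Local Open Scope cat_scope.

(** * Cofreeness of a comonad from the comparison of coalgebras *)

Definition is_coalgebra (C : category) (G : comonad C) (A : C)
    (c : mor A (G A)) : Prop :=
  counit G A ∘ c = idm A /\ comult G A ∘ c = fmap G c ∘ c.

Section AlgebraicallyCofree.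
Variables (C : category) (G : Cmd C) (T : Copt C) (q : mor (forget C G) T).

Hypothesis coalgebra_lift : forall (A : C) (t : mor A (cp_functor T A)),
  cp_counit T A ∘ t = idm A ->
  exists c : mor A (cm_functor G A), is_coalgebra c /\ cph_nt q A ∘ c = t.

Hypothesis coalgebra_hom_lift :
  forall (A B : C) (c : mor A (cm_functor G A)) (d : mor B (cm_functor G B))
    (h : mor A B),
  is_coalgebra c -> is_coalgebra d ->
  fmap (cp_functor T) h ∘ (cph_nt q A ∘ c) = cph_nt q B ∘ d ∘ h ->
  fmap (cm_functor G) h ∘ c = d ∘ h.

(** A comonad map carries [D]-coalgebras to [G]-coalgebras; here it is applied to the cofree
    coalgebra [comult D A]. *)
Lemma comonad_hom_coalgebra (D : comonad C) (g : comonad_hom D G) (A : C) :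
  is_coalgebra (A := D A) (g (D A) ∘ comult D A).
Proof.
split; first by rewrite hcompA cmh_counit comonad_counitl.
rewrite hcompA cmh_comult -!hcompA comonad_coassoc fmapM -!hcompA.
by congr (_ ∘ _); rewrite !hcompA naturality.
Qed.

(** A comonad map is recovered from the coalgebras it induces on the [D A]: this gives uniqueness
    and dictates the definition of [g0] below. *)
Lemma comonad_hom_counitE (D : comonad C) (g : comonad_hom D G) (A : C) :
  g A = fmap (cm_functor G) (counit D A) ∘ (g (D A) ∘ comult D A).
Proof.
rewrite hcompA -(naturality g (counit D A)) -hcompA.
by rewrite comonad_counitr hcompm1.
Qed.

Lemma algebraically_cofree_is_cofree : is_cofree q.
Proof.
move=> D f.
pose t A : mor (cm_functor D A) (cp_functor T (cm_functor D A)) :=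
  cph_nt f (cm_functor D A) ∘ comult D A.
have t_sec A : cp_counit T (cm_functor D A) ∘ t A = idm (cm_functor D A).
  by rewrite hcompA (cph_counit f) comonad_counitl.
pose c A := projT1 (cid (coalgebra_lift (t_sec A))).
have cP A : is_coalgebra (c A) by case: (projT2 (cid (coalgebra_lift (t_sec A)))).
have qc A : cph_nt q _ ∘ c A = t A.
  by case: (projT2 (cid (coalgebra_lift (t_sec A)))).
(* Naturality of [f] and of [comult D] makes [fmap D h] a map of [T]-coalgebras, hence of
   [G]-coalgebras. *)
have t_nat A B (h : mor A B) :
    fmap (cm_functor G) (fmap (cm_functor D) h) ∘ c A
    = c B ∘ fmap (cm_functor D) h.
  apply: coalgebra_hom_lift => //; rewrite !qc /t hcompA.
  rewrite -(naturality (cph_nt f) (fmap (cm_functor D) h)) -!hcompA.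
  by congr (_ ∘ _); rewrite (naturality (comult D)).
(* Coassociativity of [D] says that [comult D A] is a map of [T]-coalgebras. *)
have c_comult A :
    fmap (cm_functor G) (comult D A) ∘ c A = c (cm_functor D A) ∘ comult D A.
  apply: (@coalgebra_hom_lift (cm_functor D A) (cm_functor D (cm_functor D A)))
    => //; rewrite !qc /t hcompA.
  rewrite -(naturality (cph_nt f) (comult D A)) -!hcompA.
  by rewrite comonad_coassoc.
pose g0 A := fmap (cm_functor G) (counit D A) ∘ c A.
have g_nat A B (h : mor A B) :
    g0 B ∘ fmap (cm_functor D) h = fmap (cm_functor G) h ∘ g0 A.
  by rewrite -hcompA -t_nat !hcompA -!fmapM (naturality (counit D)).
have g_counit A : counit G A ∘ g0 A = counit D A.
  rewrite hcompA (naturality (counit G)) -hcompA.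
  by have [-> _] := cP A; rewrite hcompm1.
have g_comult A : comult G A ∘ g0 A
    = fmap (cm_functor G) (g0 A) ∘ g0 (cm_functor D A) ∘ comult D A.
  (* With [c_comult], this collapses [g0 (D A) ∘ comult D A] to [c A]; what remains follows from the
     coalgebra law of [c A] and naturality of [comult G]. *)
  have counitK :
      fmap (cm_functor G) (counit D (cm_functor D A))
      ∘ (fmap (cm_functor G) (comult D A) ∘ c A) = c A.
    by rewrite hcompA -[RHS]hcomp1m -fmap1 -(comonad_counitl D A) fmapM.
  rewrite -!hcompA -c_comult counitK /g0 fmapM -hcompA.
  have [_ <-] := cP A.
  by rewrite !hcompA; congr (_ ∘ _); apply: (naturality (comult G)).
exists (@ComonadHom C D G (NatTrans g_nat) g_counit g_comult); split.
  apply: copointed_homP => A /=.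
  rewrite hcompA (naturality (cph_nt q)) -hcompA qc.
  rewrite hcompA -(naturality (cph_nt f)) -hcompA.
  by rewrite comonad_counitr hcompm1.
move=> g qg; apply: comonad_homP => A /=.
rewrite (comonad_hom_counitE g) /g0; congr (_ ∘ _).
(* [c A] and the coalgebra induced by [g] have the same underlying [T]-coalgebra [t A], so lifting
   the identity identifies them. *)
have := @coalgebra_hom_lift _ _ (c A) _ (idm (cm_functor D A)) (cP A)
  (comonad_hom_coalgebra g A).
rewrite !fmap1 !hcomp1m !hcompm1 => -> //.
by rewrite qc hcompA /t -qg.
Qed.

End AlgebraicallyCofree.

(** * The copointed endofunctors of first two terms *)

Section TwoTerms.
Variables (k : comPzRingType) (lam : k).

Lemma pairmap_linear (A B : kalgebra k) (f : alg_hom A B) :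
  linear (fun x : A * A => (f x.1, f x.2)).
Proof. by move=> c x y; rewrite /= !linearP. Qed.

(** Reading [(x, x')] as [x + x' e], this is the product of [A[e]/(e^2 - lam e)] with [e] central:
    the dual numbers when [lam = 0]. *)
Definition dmul (A : kalgebra k) (x y : A * A) : A * A :=
  (x.1 * y.1, x.2 * y.1 + x.1 * y.2 + lam *: (x.2 * y.2)).

Definition dual_alg (A : kalgebra k) : kalgebra k.
Proof.
refine (@KAlgebra k (A * A)%type (1, 0) (@dmul A) _ _ _ _ _ _ _).
- move=> x y z; congr (_, _) => /=; first exact: mulrA.
  rewrite !(mulrDl, mulrDr, scalerDr) -!kscaleAl -!kscaleAr !mulrA !addrA.
  by rewrite (ACl (1*2*5*3*6*4*7))%AC.
- by move=> [x x']; rewrite /dmul /= !mul1r !mul0r add0r scaler0 addr0.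
- by move=> [x x']; rewrite /dmul /= !mulr1 !mulr0 addr0 scaler0 addr0.
- move=> x y z; congr (_, _) => /=; first exact: mulrDl.
  by rewrite !mulrDl scalerDr !addrA (ACl (1*3*5*2*4*6))%AC.
- move=> x y z; congr (_, _) => /=; first exact: mulrDr.
  by rewrite !mulrDr scalerDr !addrA (ACl (1*3*5*2*4*6))%AC.
- move=> c x y; congr (_, _) => /=; first exact: kscaleAl.
  by rewrite !scalerDr !kscaleAl !scalerA [c * lam]mulrC.
- move=> c x y; congr (_, _) => /=; first exact: kscaleAr.
  by rewrite !scalerDr -!kscaleAr !scalerA [c * lam]mulrC.
Defined.

Lemma dual_map_monoid (A B : kalgebra k) (f : alg_hom A B) :
  monoid_morphism
    ((fun x : A * A => (f x.1, f x.2)) : dual_alg A -> dual_alg B).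
Proof.
split; first by congr (_, _); [apply: rmorph1 | apply: raddf0].
move=> x y; congr (_, _) => /=; first exact: rmorphM.
by rewrite !linearD linearZ !rmorphM.
Qed.

Definition dual_map (A B : kalgebra k) (f : alg_hom A B) :
    alg_hom (dual_alg A) (dual_alg B) :=
  @AlgHom k (dual_alg A) (dual_alg B) _ (pairmap_linear f) (dual_map_monoid f).

Definition dual_functor : functor (kAlg k) (kAlg k).
Proof.
refine (@Functor (kAlg k) (kAlg k) dual_alg dual_map _ _);
by move=> *; apply: alg_homP => -[].
Defined.

Definition dual_counit_hom (A : kalgebra k) : alg_hom (dual_alg A) A.
Proof. by refine (@AlgHom k (dual_alg A) A fst _ _). Defined.

Definition dual_counit : nat_trans dual_functor (idF (kAlg k)).
Proof.
refine (@NatTrans (kAlg k) (kAlg k) dual_functor (idF _) dual_counit_hom _).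
by move=> *; apply: alg_homP.
Defined.

Definition copointedG : Copt (kAlg k) := Copointed dual_counit.

Definition square_alg (A : kalgebra k) : kalgebra k.
Proof.
refine (@KAlgebra k (A * A)%type (1, 1) (fun x y => (x.1 * y.1, x.2 * y.2))
          _ _ _ _ _ _ _).
- by move=> x y z; rewrite /= !mulrA.
- by move=> [x x']; rewrite /= !mul1r.
- by move=> [x x']; rewrite /= !mulr1.
- by move=> x y z; rewrite /= !mulrDl.
- by move=> x y z; rewrite /= !mulrDr.
- by move=> c x y; congr (_, _); apply: kscaleAl.
- by move=> c x y; congr (_, _); apply: kscaleAr.
Defined.

Definition square_map (A B : kalgebra k) (f : alg_hom A B) :
  alg_hom (square_alg A) (square_alg B).
Proof.
refine (@AlgHom k (square_alg A) (square_alg B) _ (pairmap_linear f) _).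
by split=> [|x y]; congr (_, _); first [exact: rmorph1 | exact: rmorphM].
Defined.

Definition square_functor : functor (kAlg k) (kAlg k).
Proof.
refine (@Functor (kAlg k) (kAlg k) square_alg square_map _ _);
by move=> *; apply: alg_homP => -[].
Defined.

Definition square_counit_hom (A : kalgebra k) : alg_hom (square_alg A) A.
Proof. by refine (@AlgHom k (square_alg A) A fst _ _). Defined.

Definition square_counit : nat_trans square_functor (idF (kAlg k)).
Proof.
refine (@NatTrans (kAlg k) (kAlg k) square_functor (idF _)
          square_counit_hom _).
by move=> *; apply: alg_homP.
Defined.

Definition copointedH : Copt (kAlg k) := Copointed square_counit.

Lemma first_two_linear (A : kalgebra k) :
  linear (fun a : nat -> A => (a 0%N, a 1%N)).
Proof. by []. Qed.

Definition first_twoG_hom (A : kalgebra k) :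
  alg_hom (G_alg lam A) (dual_alg A).
Proof.
refine (@AlgHom k (G_alg lam A) (dual_alg A) _ (@first_two_linear A) _).
split=> [//|a b]; congr (_, _); first exact: gmul0.
by rewrite /= [(a * b) _]gmulS !gmul0.
Defined.

Definition first_twoG : mor (forget (kAlg k) (comonadG lam)) copointedG.
Proof.
unshelve refine (@CopointedHom _ (forget_obj (comonadG lam)) copointedG
  (@NatTrans (kAlg k) (kAlg k) (G_functor lam) dual_functor
     first_twoG_hom _) _).
- by move=> *; apply: alg_homP.
- by move=> *; apply: alg_homP.
Defined.

Definition first_twoH_hom (A : kalgebra k) : alg_hom (H_alg A) (square_alg A).
Proof.
by refine (@AlgHom k (H_alg A) (square_alg A) _ (@first_two_linear A) _).
Defined.

Definition first_twoH : mor (forget (kAlg k) (comonadH k)) copointedH.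
Proof.
unshelve refine (@CopointedHom _ (forget_obj (comonadH k)) copointedH
  (@NatTrans (kAlg k) (kAlg k) (H_functor k) square_functor
     first_twoH_hom _) _).
- by move=> *; apply: alg_homP.
- by move=> *; apply: alg_homP.
Defined.

(** * Sequences of iterates, and coactions as iteration *)

Definition orbit_seq (A : Type) (f : A -> A) (x : A) (n : nat) : A :=
  iter n f x.

Lemma orbit_linear (V : lmodType k) (f : V -> V) :
  linear f -> linear (orbit_seq f).
Proof.
move=> f_lin c x y; apply/funext; elim=> [//|n IHn].
by rewrite /orbit_seq iterS -/(orbit_seq f (c *: x + y) n) IHn; apply: f_lin.
Qed.

(* Both comultiplications split a sequence as [seqdup], so in a coalgebra the
   term of index [n.+1] is obtained from the one of index [1] followed by the
   one of index [n]. *)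
Lemma coaction_iter (A : Type) (c : A -> nat -> A) :
  (forall x, c x 0%N = x) -> (forall x, seqdup (c x) = c \o c x) ->
  forall x n, c x n = iter n (c^~ 1%N) x.
Proof.
move=> c0 cD x n; elim: n x => [|n IHn] x; first exact: c0.
by rewrite iterSr -IHn -[RHS]/((c \o c x) 1%N n) -cD.
Qed.

Lemma seqdup_orbit (A : Type) (f : A -> A) (x : A) :
  seqdup (orbit_seq f x) = orbit_seq f \o orbit_seq f x.
Proof.
by do 2 apply/funext => ?; rewrite /seqdup /orbit_seq addnC iterD.
Qed.

Lemma shift_orbit (A : Type) (f : A -> A) (x : A) :
  shift (orbit_seq f x) = orbit_seq f (f x).
Proof. by apply/funext => n; rewrite /shift /orbit_seq iterSr. Qed.

(** Both coactions iterate their terms of index 1, so a map commuting with these commutes with all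
    terms. *)
Lemma coaction_hom (A B : Type) (c : A -> nat -> A) (d : B -> nat -> B)
    (h : A -> B) :
  (forall x, c x 0%N = x) -> (forall x, seqdup (c x) = c \o c x) ->
  (forall x, d x 0%N = x) -> (forall x, seqdup (d x) = d \o d x) ->
  (forall x, h (c x 1%N) = d (h x) 1%N) -> forall x, h \o c x = d (h x).
Proof.
move=> c0 cD d0 dD hcd x; apply/funext => n /=.
rewrite (coaction_iter c0 cD) (coaction_iter d0 dD).
by elim: n => //= n <-.
Qed.

(** * Cofreeness of the two comonads *)

Lemma first_twoG_cofree : is_cofree first_twoG.
Proof.
apply: algebraically_cofree_is_cofree => [A t t_sec|A B c d h [c0 cD] [d0 dD] E].
(* The section is [x |-> (x, f x)]; being an algebra map into [dual_alg A], it makes [f] a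
   derivation of weight [lam]. *)
- have t1 x : (t x).1 = x by rewrite -[RHS]/(alg_idm A x) -[alg_idm A]t_sec.
  pose f x := (t x).2.
  have f_lin : linear f by move=> a x y; rewrite /f linearP.
  have f1 : f 1 = 0 by rewrite /f rmorph1.
  have fM x y : f (x * y) = f x * y + x * f y + lam *: (f x * f y).
    by rewrite /f rmorphM /= !t1.
  have itM : monoid_morphism (orbit_seq f : A -> G_alg lam A).
    have itD u v n : orbit_seq f (u + v) n = orbit_seq f u n + orbit_seq f v n.
      by have := orbit_linear f_lin 1 u v; rewrite !scale1r => ->.
    have it0 n : orbit_seq f 0 n = 0.
      by apply: (addrI (orbit_seq f 0 n)); rewrite -itD !addr0.
    have itZ a u n : orbit_seq f (a *: u) n = a *: orbit_seq f u n.
      have := orbit_linear f_lin a u 0; rewrite addr0 => ->.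
      by rewrite seq_addE it0 addr0.
    split.
      apply/funext => -[//|n].
      by rewrite -[LHS]/(shift (orbit_seq f 1) n) shift_orbit f1 it0.
    move=> x y; apply/funext => n; elim: n x y => [|n IHn] x y.
      by rewrite [RHS]gmul0.
    (* Shifting an orbit applies [f] to its starting point, so the recursion [gmulS] takes the form
       of the Leibniz rule [fM], and the induction hypothesis applies to each product. *)
    rewrite [RHS]gmulS -[LHS]/(shift (orbit_seq f (x * y)) n) !shift_orbit fM.
    by rewrite !itD itZ !IHn.
  exists (@AlgHom k A (G_alg lam A) _ (orbit_linear f_lin) itM).
  split; [split|]; apply: alg_homP => x //=.
  + by rewrite seqdup_orbit.
  + by rewrite [RHS]surjective_pairing t1.
- apply: alg_homP; apply: coaction_hom.
  + by move=> x; apply: (congr1 (fun u : mor A A => alg_fun u x) c0).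
  + by move=> x; apply: (congr1 (fun u : alg_hom _ _ => alg_fun u x) cD).
  + by move=> x; apply: (congr1 (fun u : mor B B => alg_fun u x) d0).
  + by move=> x; apply: (congr1 (fun u : alg_hom _ _ => alg_fun u x) dD).
  + by move=> x; case: (congr1 (fun u : alg_hom _ _ => alg_fun u x) E).
Qed.

Lemma first_twoH_cofree : is_cofree first_twoH.
Proof.
apply: algebraically_cofree_is_cofree => [A t t_sec|A B c d h [c0 cD] [d0 dD] E].
- have t1 x : (t x).1 = x by rewrite -[RHS]/(alg_idm A x) -[alg_idm A]t_sec.
  pose f x := (t x).2.
  have f_lin : linear f by move=> a x y; rewrite /f linearP.
  have f1 : f 1 = 1 by rewrite /f rmorph1.
  have fM x y : f (x * y) = f x * f y by rewrite /f rmorphM.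
  have itM : monoid_morphism (orbit_seq f : A -> H_alg A).
    (* The product of [H_alg A] is pointwise, so it suffices that each iterate of the endomorphism
       [f] is multiplicative and unital. *)
    split=> [|x y]; apply/funext; elim=> //= n ->; first exact: f1.
    exact: fM.
  exists (@AlgHom k A (H_alg A) _ (orbit_linear f_lin) itM).
  split; [split|]; apply: alg_homP => x //=.
  + by rewrite seqdup_orbit.
  + by rewrite [RHS]surjective_pairing t1.
- apply: alg_homP; apply: coaction_hom.
  + by move=> x; apply: (congr1 (fun u : mor A A => alg_fun u x) c0).
  + by move=> x; apply: (congr1 (fun u : alg_hom _ _ => alg_fun u x) cD).
  + by move=> x; apply: (congr1 (fun u : mor B B => alg_fun u x) d0).
  + by move=> x; apply: (congr1 (fun u : alg_hom _ _ => alg_fun u x) dD).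
  + by move=> x; case: (congr1 (fun u : alg_hom _ _ => alg_fun u x) E).
Qed.

(** * The map of copointed endofunctors inducing [gamma] *)

Definition dual_to_square_hom (A : kalgebra k) :
  alg_hom (dual_alg A) (square_alg A).
Proof.
refine (@AlgHom k (dual_alg A) (square_alg A)
          (* The two components evaluate [x.1 + x.2 e] at the roots [0] and [lam] of [e^2 = lam e],
             which is why they are multiplicative. On coalgebras, a derivation [f] of weight [lam]
             is sent to the endomorphism [x |-> x + lam *: f x]. *)
          (fun x => (x.1, x.1 + lam *: x.2)) _ _).
- move=> c x y; congr (_, _).
  by rewrite /= !scalerDr !scalerA [c * lam]mulrC !addrA (ACl (1*3*2*4))%AC.
- split=> [|x y]; congr (_, _) => /=; first by rewrite scaler0 addr0.
  rewrite !(mulrDl, mulrDr) !scalerDr -!kscaleAl -!kscaleAr !addrA.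
  by rewrite (ACl (1*3*2*4))%AC.
Defined.

Definition dual_to_square : mor copointedG copointedH.
Proof.
unshelve refine (@CopointedHom _ copointedG copointedH
  (@NatTrans (kAlg k) (kAlg k) dual_functor square_functor
     dual_to_square_hom _) _).
- move=> A B f; apply: alg_homP => x; congr (_, _).
  by rewrite /= linearD linearZ.
- by move=> *; apply: alg_homP.
Defined.

Lemma gamma_cofree_on_map :
  is_cofree_on_map first_twoG first_twoH dual_to_square (gamma lam).
Proof.
apply: copointed_homP => A; apply: alg_homP => a.
by congr (_, _); [apply: gam0 | rewrite /= gamS !gam0].
Qed.

End TwoTerms.

(* A commutative Q-algebra is a commutative ring [k] with a ring morphism from
   [rat]. *)
Theorem proposition4p4 (k : comPzRingType) (QtoK : {rmorphism rat -> k})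
    (lam : k) :
  exists (S T : Copt (kAlg k))
         (p : mor (forget (kAlg k) (comonadG lam)) S)
         (q : mor (forget (kAlg k) (comonadH k)) T),
    [/\ is_cofree p, is_cofree q &
        exists phi : mor S T, is_cofree_on_map p q phi (gamma lam)].
Proof.
exists (copointedG lam), (copointedH k), (first_twoG lam), (first_twoH k).
split; [exact: first_twoG_cofree | exact: first_twoH_cofree |].
by exists (dual_to_square lam); apply: gamma_cofree_on_map.
Qed.
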